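(* Let $n\in\{1,2\}$ and let $\{\mathbf{s}_1,\dots,\mathbf{s}_M\}\subset\mathbb{R}^n$ be any constellation of $M\ge 2$ distinct points, used over the AWGN channel with maximum-likelihood detection. Then the symbol error rate $P_e$ is a convex function, and the probability of correct decision $P_c=1-P_e$ a concave function, of the SNR $\gamma$; precisely, for all $\gamma>0$, $$\frac{d^2P_e}{d\gamma^2}>0,\qquad \frac{d^2P_c}{d\gamma^2}<0 .$$
   Context: Setting: a constellation is a set of $M\ge2$ distinct points $\mathbf{s}_1,\dots,\mathbf{s}_M\in\mathbb{R}^n$, normalized by $\frac1M\sum_{i=1}^M|\mathbf{s}_i|^2=1$ ($|\cdot|$ is the Euclidean norm). The received vector is $\mathbf{r}=\mathbf{s}+\boldsymbol{\xi}$, where $\mathbf{s}$ is a random constellation point with prior probabilities $\Pr[\mathbf{s}=\mathbf{s}_i]\ge 0$ summing to 1 (not depending on the noise), and $\boldsymbol\xi\sim\mathcal N(\mathbf 0,\sigma_0^2\mathbf I)$ is independent of $\mathbf{s}$. The SNR is $\gamma=1/\sigma_0^2>0$. The maximum-likelihood (minimum distance) detector outputs $\hat{\mathbf{s}}=\arg\min_{\mathbf{s}_i}|\mathbf{r}-\mathbf{s}_i|$. The decision region of $\mathbf{s}_i$, with the origin shifted to $\mathbf{s}_i$, is the convex polyhedron $\Omega_i=\{\mathbf{x}\in\mathbb{R}^n:\ \mathbf{a}_j^T\mathbf{x}\le b_j\ \ \forall j\ne i\}$ with $\mathbf{a}_j=(\mathbf{s}_j-\mathbf{s}_i)/|\mathbf{s}_j-\mathbf{s}_i|$,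 $b_j=\frac12|\mathbf{s}_j-\mathbf{s}_i|$. The probability of correct decision given $\mathbf{s}=\mathbf{s}_i$ is $P_{ci}(\gamma)=\int_{\Omega_i}\left(\frac{\gamma}{2\pi}\right)^{n/2}e^{-\gamma|\mathbf{x}|^2/2}\,d\mathbf{x}$; $P_{ei}=1-P_{ci}$; and $P_e=\sum_{i=1}^M P_{ei}\Pr[\mathbf{s}=\mathbf{s}_i]$, $P_c=1-P_e$. *)

(* Defs.v *)
From HB Require Import structures.
From mathcomp Require Import all_boot all_order all_algebra.
From mathcomp Require Import all_classical all_reals all_analysis.

Set Implicit Arguments.
Unset Strict Implicit.
Unset Printing Implicit Defensive.
Import Order.TTheory GRing.Theory Num.Theory.
Import numFieldNormedType.Exports.

Local Open Scope classical_set_scope.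
Local Open Scope ring_scope.

Definition rV_display : measure_display.
Proof. exact. Qed.

(* [R^n] as the space of row vectors, with the product of the Borel
   sigma-algebras of the coordinates. *)
Section measurable_rV.
Variables (R : realType) (n : nat).

Let coors (i : 'I_n) (v : 'rV[R]_n) : measurableTypeR R := v ord0 i.

Let rV_set0 : g_sigma_preimage coors set0.
Proof. exact: sigma_algebra0. Qed.

Let rV_setC A : g_sigma_preimage coors A -> g_sigma_preimage coors (~` A).
Proof. exact: sigma_algebraC. Qed.

Let rV_bigcup (F : (set 'rV[R]_n)^nat) :
  (forall i, g_sigma_preimage coors (F i)) ->
  g_sigma_preimage coors (\bigcup_i (F i)).
Proof. exact: sigma_algebra_bigcup. Qed.

HB.instance Definition _ := @isMeasurable.Build rV_display
  'rV[R]_n (g_sigma_preimage coors) rV_set0 rV_setC rV_bigcup.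

Lemma measurable_coord (i : 'I_n) :
  measurable_fun [set: 'rV[R]_n] (fun v => v ord0 i : measurableTypeR R).
Proof.
move=> _ Y mY; rewrite setTI; apply: sub_sigma_algebra => /=.
rewrite -bigcup_seq/=; exists i => /=; first by rewrite mem_index_enum.
by exists Y => //; rewrite setTI.
Qed.

Lemma measurable_fun_rV d (T : measurableType d) (f : T -> 'rV[R]_n) :
  (forall i, measurable_fun setT (fun t => f t ord0 i : measurableTypeR R)) ->
  measurable_fun setT f.
Proof.
move=> mf _ A mA; rewrite setTI.
pose P := [set B : set 'rV[R]_n | measurable (f @^-1` B)].
suff : measurable `<=` P by apply.
apply: smallest_sub.
  split=> [|B|B]; rewrite /P /=.
  - by rewrite preimage_set0; exact: measurable0.
  - by move=> mB; rewrite setTD -preimage_setC; apply: measurableC.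
  - by move=> mB; rewrite preimage_bigcup; apply: bigcup_measurable => k _; exact: mB.
rewrite -bigcup_seq/=; apply: bigcup_sub => i _ _ [B mB <-].
by rewrite /P /= setTI -[X in measurable X]setTI; exact: mf.
Qed.

End measurable_rV.

Section lebesgue_rV.
Variable R : realType.

Definition cons_rV (n : nat) (xv : measurableTypeR R * 'rV[R]_n) :
  'rV[R]_n.+1 := \row_i oapp (fun j => xv.2 ord0 j) xv.1 (unlift ord0 i).

Lemma measurable_cons_rV n : measurable_fun setT (@cons_rV n).
Proof.
apply: measurable_fun_rV => i; case: (unliftP ord0 i) => [j|] ->.
  rewrite (_ : (fun _ => _) = (fun v : 'rV[R]_n => v ord0 j) \o snd).
    by apply: measurableT_comp => //; exact: measurable_coord.
  by apply/funext => xv /=; rewrite mxE liftK.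
rewrite (_ : (fun _ => _) = fst); first exact: measurable_fst.
by apply/funext => xv /=; rewrite mxE unlift_none.
Qed.

Lemma cons_rV_bij n : bijective (@cons_rV n).
Proof.
exists (fun v : 'rV[R]_n.+1 => (v ord0 ord0, \row_j v ord0 (lift ord0 j))).
  move=> [x v]; rewrite /cons_rV mxE unlift_none /=; congr pair.
  by apply/rowP => j; rewrite !mxE liftK.
move=> v; apply/rowP => i; rewrite mxE.
by case: (unliftP ord0 i) => [j|] -> /=; rewrite ?mxE.
Qed.

Section cons_measure.
Variables (n : nat) (mu : {sigma_finite_measure set 'rV[R]_n -> \bar R}).

Definition cons_measure : set 'rV[R]_n.+1 -> \bar R :=
  pushforward (lebesgue_measure \x mu)%E (@cons_rV n).


Let cons_measure0 : cons_measure set0 = 0%E.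
Proof. by rewrite /cons_measure /pushforward preimage_set0 measure0. Qed.

Let cons_measure_ge0 A : (0 <= cons_measure A)%E.
Proof. by rewrite /cons_measure /pushforward measure_ge0. Qed.

Let cons_measure_sigma_additive : semi_sigma_additive cons_measure.
Proof.
have mc B : measurable B -> measurable (@cons_rV n @^-1` B).
  by move=> mB; rewrite -[X in measurable X]setTI; exact: measurable_cons_rV.
move=> F mF tF mUF; rewrite /cons_measure /pushforward preimage_bigcup.
apply: measure_semi_sigma_additive.
- by move=> k; exact: mc.
- apply/trivIsetP => /= i j _ _ ij; rewrite -preimage_setI.
  by move/trivIsetP : tF => /(_ _ _ _ _ ij) ->//; rewrite preimage_set0.
- by rewrite -preimage_bigcup; exact: mc.
Qed.

HB.instance Definition _ := isMeasure.Build _ _ _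
  cons_measure cons_measure0 cons_measure_ge0 cons_measure_sigma_additive.

Let cons_measure_sigma_finite : sigma_finite setT cons_measure.
Proof.
have /sigma_finiteP[F [TF ndF Foo]] := sigma_finiteT (@lebesgue_measure R).
have /sigma_finiteP[G [TG ndG Goo]] := sigma_finiteT mu.
have [g gK Kg] := cons_rV_bij n.
have mg : measurable_fun setT (g : _ -> measurableTypeR R * 'rV[R]_n).
  have -> : g = fun v => (v ord0 ord0, \row_j v ord0 (lift ord0 j)).
    apply/funext => v; apply: (can_inj gK); rewrite Kg.
    apply/rowP => i; rewrite mxE.
    by case: (unliftP ord0 i) => [j|] -> /=; rewrite ?mxE.
  apply/measurable_fun_pairP; split; first exact: measurable_coord.
  apply: measurable_fun_rV => j.
  rewrite (_ : (fun _ => _) = fun v : 'rV[R]_n.+1 => v ord0 (lift ord0 j)).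
    exact: measurable_coord.
  by apply/funext => v; rewrite /= mxE.
exists (fun k => g @^-1` (F k `*` G k)).
  rewrite -preimage_bigcup (_ : \bigcup_k _ = setT) ?preimage_setT//.
  rewrite -setXTT TF TG predeqE => -[x y]; split=> [[k _ []/= ? ?]|].
    by split; exists k.
  move=> [/= [k _ Fkx] [l _ Gly]]; exists (maxn k l) => //; split.
    by move: x Fkx; exact/subsetPset/ndF/leq_maxl.
  by move: y Gly; exact/subsetPset/ndG/leq_maxr.
move=> k; have [mFk Fk] := Foo k; have [mGk Gk] := Goo k; split.
  by rewrite -[X in measurable X]setTI; apply: mg => //; exact: measurableX.
rewrite /cons_measure /pushforward -comp_preimage.
rewrite (_ : g \o _ = id) ?preimage_id; last by apply/funext => x /=; rewrite gK.
by rewrite product_measure1E// lte_mul_pinfty// ge0_fin_numE.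
Qed.

HB.instance Definition _ := Measure_isSigmaFinite.Build _ _ _
  cons_measure cons_measure_sigma_finite.

End cons_measure.

(* n-dimensional Lebesgue measure (on the Borel sets), as the iterated product
   of the one-dimensional one; 'rV_0 is a point, of mass 1. *)
Fixpoint lebesgue_rV (n : nat) : {sigma_finite_measure set 'rV[R]_n -> \bar R} :=
  match n with
  | 0 => \d_(0 : 'rV[R]_0)
  | n'.+1 => cons_measure (lebesgue_rV n')
  end.

Lemma lebesgue_rV_box n (A : 'I_n -> set (measurableTypeR R)) :
  (forall i, measurable (A i)) ->
  lebesgue_rV n [set v | forall i, A i (v ord0 i)] =
  (\prod_(i < n) lebesgue_measure (A i))%E.
Proof.
elim: n A => [|n IHn] A mA.
  rewrite big_ord0 (_ : mkset _ = setT) /= ?diracT//.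
  by apply/seteqP; split => // v _ [].
rewrite big_ord_recl -IHn; last by move=> i; exact: mA.
rewrite -product_measure1E//; last first.
  rewrite (_ : mkset _ =
      \bigcap_(i : 'I_n) ((fun v => v ord0 i) @^-1` A (lift ord0 i))).
    apply: fin_bigcap_measurable => // i _.
    by rewrite -[X in measurable X]setTI; apply: measurable_coord.
  by apply/seteqP; split => v /= Av i; [move=> _; exact: Av|exact: Av].
rewrite /cons_measure /pushforward; congr product_measure1.
apply/seteqP; split=> -[x v] /=.
  move=> Av; split=> [|i].
    by have := Av ord0; rewrite mxE unlift_none.
  by have := Av (lift ord0 i); rewrite mxE liftK.
by move=> [Ax Av] i; rewrite mxE; case: (unliftP ord0 i) => [j|] -> /=.
Qed.

End lebesgue_rV.

Section constellation.
Variable R : realType.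

Section geometry.
Variable n : nat.

Definition dot (x y : 'rV[R]_n) : R := \sum_(k < n) x ord0 k * y ord0 k.

(* The library norm on 'rV[R]_n is the sup norm, hence this definition. *)
Definition enorm (x : 'rV[R]_n) : R := Num.sqrt (dot x x).

End geometry.

Variables (n M : nat) (s : 'I_M -> 'rV[R]_n).

Definition normal_vec (i j : 'I_M) : 'rV[R]_n :=
  (enorm (s j - s i))^-1 *: (s j - s i).

Definition offset (i j : 'I_M) : R := 2^-1 * enorm (s j - s i).

(* The minimum-distance decision region of [s i], translated so that [s i] is
   the origin. *)
Definition decision_region (i : 'I_M) : set 'rV[R]_n :=
  [set x | forall j, j != i -> dot (normal_vec i j) x <= offset i j].

(* Density at [x] of the noise vector N(0, gamma^-1 I), gamma being the SNR. *)
Definition noise_pdf (gamma : R) (x : 'rV[R]_n) : R :=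
  (gamma / (2 * pi)) `^ (n%:R / 2) * expR (- (gamma * enorm x ^+ 2 / 2)).

Definition prob_correct_given (i : 'I_M) (gamma : R) : R :=
  \int[lebesgue_rV R n]_(x in decision_region i) noise_pdf gamma x.

Definition prob_error_given (i : 'I_M) (gamma : R) : R :=
  1 - prob_correct_given i gamma.

(* [p i] is the prior probability of [s i]. *)
Definition symbol_error_rate (p : 'I_M -> R) (gamma : R) : R :=
  \sum_(i < M) prob_error_given i gamma * p i.

Definition prob_correct (p : 'I_M -> R) (gamma : R) : R :=
  1 - symbol_error_rate p gamma.

End constellation.

(* Main.v *)
(* In dimension 2 the decision region is the unit ball {N <= 1} of a polyhedral
   gauge N. In polar coordinates (r, theta), with R(theta) the distance from the
   origin to the boundary, the correct decision probability is the mean over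
   theta of 1 - exp (- gamma R(theta)^2 / 2): the Gaussian normalisation cancels
   the area element. Hence the error probability is a superposition of decreasing
   exponentials of gamma, i.e., the Laplace transform of a nonnegative measure,
   whose second derivative is positive as soon as R is finite on a set of
   positive measure. The polar change of variables is replaced here by
   (x, y) = (x, x t) on each half-plane, which only requires the scaling of the
   one-dimensional Lebesgue measure; the angular density d theta becomes
   dt / (1 + t^2). The case n = 1 is the case n = 2 for the region times the
   real line. *)
Require Import Defs.
From mathcomp Require Import all_boot all_order all_algebra.
From mathcomp Require Import all_classical all_reals all_analysis.
From mathcomp Require Import measurable_realfun ring lra.

Set Implicit Arguments.
Unset Strict Implicit.
Unset Printing Implicit Defensive.
Import Order.TTheory GRing.Theory Num.Theory.
Import numFieldNormedType.Exports.

Local Open Scope ring_scope.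
Local Open Scope classical_set_scope.

(** * Laplace transforms and second derivatives *)

(** If the integral were 0, the nonnegative [f] would vanish outside a null set, and that null set
    would have to contain [A]. *)
Lemma Rintegral_gt0 d (T : measurableType d) (R : realType)
    (mu : {measure set T -> \bar R}) (f : T -> R) (A : set T) :
  mu.-integrable setT (EFin \o f) -> (forall t, 0 <= f t) ->
  measurable A -> (0 < mu A)%E -> (forall t, A t -> 0 < f t) ->
  0 < \int[mu]_t f t.
Proof.
move=> fi f0 mA muA fA.
have mf : measurable_fun setT f by apply/measurable_EFinP; case/integrableP: fi.
rewrite lt_neqAle Rintegral_ge0// andbT; apply/eqP => /esym I0.
have : (\int[mu]_t `|(EFin \o f) t| = 0)%E.
  rewrite -[RHS]/(0%:E) -I0 /Rintegral fineK; last exact: integrable_fin_num.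
  by apply: eq_integral => t _ /=; rewrite ger0_norm.
move/measurable_EFinP in mf.
move/(ae_eq_integral_abs mu measurableT mf) => [N [mN muN subN]].
have : (mu A <= mu N)%E.
  apply: le_measure; rewrite ?inE//; apply: subset_trans subN => t At /= /(_ I) [].
  by move=> ft; have := fA _ At; rewrite ft ltxx.
by rewrite leNgt muN muA.
Qed.

Section laplace.
Context d (T : measurableType d) (R : realType).
Context (mu : {measure set T -> \bar R}) (u : T -> R).
Hypotheses (u_measurable : measurable_fun setT u) (u_ge0 : forall t, 0 <= u t).

(** Asking for all positive [g] at once makes the class stable under multiplication of the weight by
    [- u t]: integrability at [g] follows from integrability of the old weight at [g / 2]. *)
Definition laplace_integrable (w : T -> R) := forall g, 0 < g ->
  mu.-integrable setT (EFin \o (fun t => w t * expR (- (g * u t)))).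

Definition laplace (w : T -> R) (g : R) :=
  \int[mu]_t (w t * expR (- (g * u t))).

(* From g u / 2 <= exp (g u / 2). *)
Lemma laplace_dominated (w : T -> R) (g x : R) t : 0 < g -> g <= x ->
  `|- u t * w t * expR (- (x * u t))| <=
  2 / g * `|w t * expR (- (g / 2 * u t))|.
Proof.
move=> g0 gx; rewrite !normrM normrN !(ger0_norm (expR_ge0 _)) (ger0_norm (u_ge0 _)).
rewrite -mulrA mulrCA [leRHS]mulrCA ler_wpM2l//.
have -> : - (g / 2 * u t) = (g / 2 * u t) + - (g * u t) by field.
rewrite expRD mulrA ler_pM ?expR_ge0//.
  rewrite -ler_pdivrMl ?divr_gt0// invf_div.
  by apply: le_trans (expR_ge1Dx _); rewrite lerDr.
by rewrite ler_expR lerN2 ler_wpM2r.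
Qed.

Lemma laplace_integrableM (w : T -> R) : measurable_fun setT w ->
  laplace_integrable w -> laplace_integrable (fun t => - u t * w t).
Proof.
move=> mw wi g g0.
apply: (@le_integrable _ _ _ mu _ measurableT _
  (fun t => ((2 / g)%:E * (w t * expR (- (g / 2 * u t)))%:E)%E)).
- apply/measurable_EFinP; apply: measurable_funM.
    by apply: measurable_funM => //; exact: measurableT_comp.
  apply: measurableT_comp => //; apply: measurableT_comp => //.
  exact: measurable_funM.
- move=> t _ /=; rewrite lee_fin; apply: le_trans (laplace_dominated _ _ g0 (lexx g)) _.
  by rewrite [leRHS]normrM (@ger0_norm _ (2 / g))// divr_ge0// ltW.
- by apply: integrableZl => //; apply: wi; rewrite divr_gt0.
Qed.

(** Differentiation under the integral sign. The derivative is again a Laplace transform, with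
    weight [- u t * w t], so that the lemma can be iterated. *)
Lemma is_derive_laplace (w : T -> R) (g : R) :
  laplace_integrable w -> 0 < g ->
  is_derive g 1 (laplace w) (laplace (fun t => - u t * w t) g).
Proof.
move=> wi g0.
pose f (x : R) t := w t * expR (- (x * u t)).
have df (x : R) t : is_derive x 1 (f^~ t) (- u t * w t * expR (- (x * u t))).
  rewrite /f; apply: trigger_derive.
  by rewrite /GRing.scale/=; ring.
have g2 : 0 < g / 2 by rewrite divr_gt0.
have Ig : (`]g / 2, g + 1[%classic : set R) g.
  by rewrite /= in_itv/=; apply/andP; split; lra.
(* Every [x] of the interval exceeds [g / 2], so [laplace_dominated] at [g / 2] bounds all these
   derivatives by one function of [t]; this is where [g / 2 / 2] comes from. *)
have dom (x : R) t : (`]g / 2, g + 1[%classic : set R) x -> setT t ->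
    `|(fun x y => (f^~ y)^`() x) x t| <=
    2 / (g / 2) * `|w t * expR (- (g / 2 / 2 * u t))|.
  rewrite /= in_itv/= => /andP[gx _] _.
  rewrite derive1E (@derive_val _ _ _ _ _ _ _ (df x t)).
  exact: laplace_dominated (ltW gx).
have fi (x : R) : (`]g / 2, g + 1[%classic : set R) x ->
    mu.-integrable setT (EFin \o f x).
  by rewrite /= in_itv/= => /andP[gx _]; apply: wi; exact: lt_trans gx.
have dfx (x : R) (t : T) : (`]g / 2, g + 1[%classic : set R) x -> setT t ->
  derivable (f^~ t) x 1 by move=> _ _; exact: ex_derive.
have G0 t : 0 <= 2 / (g / 2) * `|w t * expR (- (g / 2 / 2 * u t))|.
  by rewrite mulr_ge0// divr_ge0// ltW.
have Gi : mu.-integrable setT (EFin \o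
    (fun t => 2 / (g / 2) * `|w t * expR (- (g / 2 / 2 * u t))|)).
  apply: (@integrableZl _ _ _ mu _ measurableT (2 / (g / 2))
    (EFin \o (fun t => `|w t * expR (- (g / 2 / 2 * u t))|))).
  by apply: (@integrable_norm _ _ _ mu); apply: wi; rewrite divr_gt0.
apply: DeriveDef.
  exact: (@derivable_under_integral _ _ _ _ _ _ measurableT _ _ _ Ig fi dfx
    _ G0 Gi dom).
rewrite -derive1E.
rewrite (@differentiation_under_integral _ _ _ _ _ _ measurableT _ _ _ Ig fi dfx
    _ G0 Gi dom).
apply: eq_Rintegral => t _; rewrite -[LHS]/((f^~ t)^`() g).
by rewrite derive1E (@derive_val _ _ _ _ _ _ _ (df g t)).
Qed.

End laplace.

(** * Second derivatives and convexity on the positive half-line *)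

Section derive2.
Local Open Scope convex_scope.
Context (R : realType) (f f1 f2 : R -> R).
Hypothesis df : forall x : R, 0 < x -> is_derive x 1 f (f1 x).
Hypothesis df1 : forall x : R, 0 < x -> is_derive x 1 f1 (f2 x).

(** The formula [f1] is known to be the derivative at positive points only; agreement near [x] is
    enough to differentiate once more at [x]. *)
Lemma near_derive1E (x : R) : 0 < x -> \near x, f1 x = f^`() x.
Proof.
move=> x0; near=> y; rewrite derive1E.
apply/esym; apply: (@derive_val _ _ _ _ _ _ _ (df _)).
by near: y; exact: lt_nbhsr.
Unshelve. all: by end_near. Qed.

Lemma is_derive_derive1 (x : R) : 0 < x -> is_derive x 1 f^`() (f2 x).
Proof. by move=> x0; exact: near_eq_is_derive (near_derive1E x0) (df1 x0). Qed.

Lemma convex_function_derive2 : (forall x, 0 < x -> 0 <= f2 x) ->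
  convex_function (`]0, +oo[ : set R^o) f.
Proof.
move=> f2_ge0 t.
(* The criterion [second_derivative_convex] is about an ordered pair of endpoints; [convC] exchanges
   them otherwise. *)
suff wlog_le (x y : R^o) (s : {i01 R}) : 0 < x -> x <= y ->
    f (x <| s |> y) <= (f x : R^o) <| s |> (f y : R^o).
  move=> x y; rewrite !inE/= !in_itv/= !andbT => x0 y0.
  have [xy|/ltW yx] := leP x y; first exact: wlog_le.
  by rewrite convC [leRHS]convC; exact: wlog_le.
move=> x0 xy.
have cf z : 0 < z -> {for z, continuous f}.
  by move=> z0; apply: differentiable_continuous; apply/derivable1_diffP;
     have := df z0 => ?; exact: ex_derive.
have dE : ('D_1 f : R -> R) = f^`() by apply/funext => z; rewrite derive1E.
apply: second_derivative_convex => //.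
- move=> z /andP[xz _]; have z0 := lt_trans x0 xz.
  by rewrite dE (@derive_val _ _ _ _ _ _ _ (is_derive_derive1 z0)) f2_ge0.
- by apply: cvg_at_left_filter; apply: cf; exact: lt_le_trans xy.
- by apply: cvg_at_right_filter; exact: cf.
- move=> z; rewrite in_itv/= => /andP[xz _].
  by have := df (lt_trans x0 xz) => ?; exact: ex_derive.
- move=> z; rewrite in_itv/= => /andP[xz _]; rewrite dE.
  by have := is_derive_derive1 (lt_trans x0 xz) => ?; exact: ex_derive.
Qed.

End derive2.

(** * Change of variables *)

Section change_of_variable.
Context {R : realType}.
Local Notation mu := (@lebesgue_measure R).

(** The left-hand side is a measure in [A] that agrees with Lebesgue measure on the intervals []a,
    b]], hence everywhere by uniqueness. *)
Lemma lebesgue_measure_scale (x : R) (A : set R) : 0 < x -> measurable A ->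
  (x%:E * mu ((fun t : measurableTypeR R => x * t : measurableTypeR R)%R @^-1` A) = mu A)%E.
Proof.
move=> x0 mA.
pose phi : measurableTypeR R -> measurableTypeR R := fun t => x * t.
have mphi : measurable_fun setT phi by exact: mulrl_measurable.
have x0' : 0 <= x by exact: ltW.
pose nu := mscale (NngNum x0') (pushforward mu phi).
set nup := nu mphi.
rewrite -[LHS]/(nup A); apply/esym/lebesgue_measure_unique => //= _ [[a b]] _ <-.
rewrite /nup /nu /mscale/= /pushforward/=.
rewrite [X in (_ * mu X)%E](_ : _ = `]a / x, b / x]); last first.
  apply/seteqP; split => t /=; rewrite !in_itv/= ltr_pdivrMr// ler_pdivlMr//;
  by rewrite (mulrC t).
rewrite !lebesgue_measure_itv/= !lte_fin ltr_pM2r ?invr_gt0//.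
case: ifPn => _; last by rewrite mule0.
by rewrite -!EFinB -EFinM -mulrBl mulrC divfK// gt_eqF.
Qed.

Lemma ge0_integral_scale (x : R) (f : R -> \bar R) : 0 < x ->
  measurable_fun setT f -> (forall t, 0 <= f t)%E ->
  (\int[mu]_y f y = \int[mu]_t (x%:E * f (x * t)%R))%E.
Proof.
move=> x0 mf f0.
pose phi : measurableTypeR R -> measurableTypeR R := fun t => x * t.
have mphi : measurable_fun setT phi by exact: mulrl_measurable.
have x0' : 0 <= x by exact: ltW.
pose nu := mscale (NngNum x0') (pushforward mu phi).
set nup := nu mphi.
transitivity (\int[nup]_y f y)%E.
  apply: eq_measure_integral => //= A mA _.
  by rewrite -(lebesgue_measure_scale x0 mA).
rewrite ge0_integral_mscale//= ge0_integral_pushforward//.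
rewrite preimage_setT ge0_integralZl_EFin//.
exact: measurableT_comp.
Qed.

Lemma ge0_integral_fold (f : R -> \bar R) :
  measurable_fun setT f -> (forall t, 0 <= f t)%E ->
  (\int[mu]_x f x = \int[mu]_(x in `[0%R, +oo[) f x +
                    \int[mu]_(x in `[0%R, +oo[) f (- x)%R)%E.
Proof.
move=> mf f0.
rewrite [X in (_ + X)%E](@ge0_integration_by_substitution0 _ (fun x => f (- x)%R))//; last first.
  exact: measurableT_comp.
under [X in (_ + X)%E]eq_integral do rewrite opprK.
(* Dropping the null endpoint 0 makes the two half-lines disjoint. *)
rewrite -[X in (_ + X)%E]integral_itv_bndo_bndc; last exact: measurable_funTS.
rewrite addeC -ge0_integral_setU//=.
- by congr (integral _ _ _); apply/seteqP; split => // x _ /=;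
    rewrite !in_itv/= andbT; case: ltP; [left|right].
- exact: measurable_funTS.
- by apply/disj_setPS => x [] /=; rewrite !in_itv/= andbT => /lt_geF ->.
Qed.

End change_of_variable.

(** * The Gaussian integral along a ray *)

Section radial.
Context {R : realType}.
Local Notation mu := (@lebesgue_measure R).
Variable a : R.
Hypothesis a0 : 0 < a.

Let f (x : R) := x * expR (- (a * x ^+ 2 / 2)).
Let F (x : R) := - expR (- (a * x ^+ 2 / 2)) / a.

Let dF (x : R) : is_derive x 1 F (f x).
Proof.
rewrite /F /f; apply: trigger_derive.
rewrite /GRing.scale/=; field.
by rewrite gt_eqF.
Qed.

Let cF : continuous F.
Proof.
move=> x; apply: differentiable_continuous; apply/derivable1_diffP.
by have := dF x => ?; exact: ex_derive.
Qed.

Let cf : continuous f.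
Proof.
have df (x : R) : derivable f x 1 by rewrite /f; apply: ex_derive.
by move=> x; apply: differentiable_continuous; apply/derivable1_diffP.
Qed.

Let F'f (x : R) : F^`() x = f x.
Proof. by rewrite derive1E (@derive_val _ _ _ _ _ _ _ (dF x)). Qed.

Let F0 : F 0 = - a^-1.
Proof. by rewrite /F expr0n/= mulr0 mul0r oppr0 expR0 mulN1r. Qed.

Let cvgF : F x @[x --> +oo] --> (0 : R).
Proof.
have FE : F = (fun x => - expR (- (a / 2 * x ^+ 2)) * a^-1).
  by apply/funext => x; rewrite /F; congr (- expR (- _) / _); field.
rewrite FE -[X in _ --> X](mul0r a^-1) -oppr0.
apply: cvgM; last exact: cvg_cst.
apply: cvgN; apply: (cvg_comp (fun x => a / 2 * x ^+ 2) (fun x => expR (- x))).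
  by apply: gt0_cvgMry; [rewrite divr_gt0|exact: cvgr_expr2].
exact: cvgr_expR.
Qed.

(** The Jacobian factor [x] gives the integrand the elementary primitive [F]. The ray leaves the
    ball at [k^-1], or never if [k = 0]; in that case the exponential on the right is 1 by division
    by zero, and the boolean factor removes it. *)
Lemma integral_radial (k : R) : 0 <= k ->
  (\int[mu]_(x in `[0%R, +oo[)
     (x * (if x * k <= 1 then expR (- (a * x ^+ 2 / 2)) else 0))%:E =
   ((1 - (0 < k)%R%:R * expR (- (a / (2 * k ^+ 2)))) / a)%:E)%E.
Proof.
rewrite le_eqVlt => /predU1P[<-|k0].
  under eq_integral do rewrite mulr0 ler01.
  rewrite (@ge0_continuous_FTC2y _ f F 0 0)//=.
  - by rewrite F0 ltxx mul0r subr0 mul1r -EFinB sub0r opprK.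
  - by move=> x x0; rewrite /f mulr_ge0// expR_ge0.
  - exact: continuous_subspaceT.
  - by apply: cvg_at_right_filter; exact: cF.
have k1 : 0 < k^-1 by rewrite invr_gt0.
transitivity (\int[mu]_(x in `[0%R, k^-1%R]) (f x)%:E)%E.
  rewrite [LHS]integral_mkcond [RHS]integral_mkcond.
  apply: eq_integral => x _; rewrite !patchE !mem_setE !in_itv/= andbT.
  case: (leP 0 x) => //= x0.
  by rewrite -[k^-1]mul1r -ler_pdivrMr ?invr_gt0// invrK; case: ifPn => // _; rewrite mulr0.
rewrite (@continuous_FTC2 _ f F)//.
- rewrite F0 k0 mul1r /F -EFinB; congr EFin.
  have -> : a / (2 * k ^+ 2) = a * k^-1 ^+ 2 / 2 by field; rewrite gt_eqF.
  by field; rewrite gt_eqF.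
- exact: continuous_subspaceT.
- split.
  + by move=> x _; have := dF x => ?; exact: ex_derive.
  + by apply: cvg_at_right_filter; exact: cF.
  + by apply: cvg_at_left_filter; exact: cF.
Qed.

End radial.

(** * Gaussian mass of the unit ball of a gauge *)

Section gauge.
Context {R : realType}.
Local Notation mu := (@lebesgue_measure R).

Definition gauss2 (g : R) (z : R * R) : R :=
  g / (2 * pi) * expR (- (g * (z.1 ^+ 2 + z.2 ^+ 2) / 2)).

Lemma gauss2_ge0 (g : R) z : 0 < g -> 0 <= gauss2 g z.
Proof. by move=> g0; rewrite mulr_ge0 ?expR_ge0// divr_ge0 ?mulr_ge0 ?pi_ge0// ltW. Qed.

Lemma measurable_gauss2 (g : R) : measurable_fun setT (gauss2 g).
Proof.
apply: measurable_funM => //; apply: measurableT_comp => //.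
apply: measurableT_comp => //; apply: measurable_funM => //.
apply: measurable_funM => //; apply: measurable_funD;
  by apply: measurable_funX => //; exact: measurable_snd.
Qed.

Variable N : R * R -> R.

Definition gauge_ball_gauss (g : R) (z : R * R) : R :=
  if N z <= 1 then gauss2 g z else 0.

(* Along the direction (1, t) the ball ends at distance sqrt (1 + t^2) / N (1, t);
   radial_decay is half the square of it. If N (1, t) = 0 the ray stays in the
   ball: then radial_decay is the junk value 0, and radial_weight vanishes. *)
Definition radial_decay (t : R) : R := (1 + t ^+ 2) / (2 * N (1, t) ^+ 2).

Definition radial_weight (t : R) : R :=
  (0 < N (1, t))%R%:R / (2 * pi * (1 + t ^+ 2)).

Hypothesis N_ge0 : forall z, 0 <= N z.
Hypothesis N_scale : forall x t, 0 < x -> N (x, x * t) = x * N (1, t).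
Hypothesis mN : measurable_fun setT N.

Lemma gauge_ball_gauss_ge0 g z : 0 < g -> 0 <= gauge_ball_gauss g z.
Proof. by move=> g0; rewrite /gauge_ball_gauss; case: ifP => // _; exact: gauss2_ge0. Qed.

Lemma measurable_gauge_ball_gauss g : measurable_fun setT (gauge_ball_gauss g).
Proof.
apply: measurable_fun_ifT => //; last exact: measurable_gauss2.
exact: measurable_fun_ler.
Qed.

(** The integrand in the coordinates [(x, t)] with [y = x * t], including the Jacobian [x].
    Extension by 0 to [x <= 0] allows Tonelli on the whole plane. *)
Let polar g (z : R * R) : R :=
  if 0 < z.1 then z.1 * gauge_ball_gauss g (z.1, z.1 * z.2) else 0.

Let measurable_polar g : measurable_fun setT (polar g).
Proof.
apply: measurable_fun_ifT => //.
  by apply: measurable_fun_ltr => //; exact: measurable_fst.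
apply: measurable_funM; first exact: measurable_fst.
apply: (measurableT_comp (measurable_gauge_ball_gauss g)).
apply/measurable_fun_pairP; split; first exact: measurable_fst.
by apply: measurable_funM; [exact: measurable_fst|exact: measurable_snd].
Qed.

Let polar_ge0 g z : 0 < g -> 0 <= polar g z.
Proof.
move=> g0; rewrite /polar; case: ifP => // /ltW z0.
by rewrite mulr_ge0// gauge_ball_gauss_ge0.
Qed.

Let oneDsqr_gt0 (t : R) : 0 < 1 + t ^+ 2.
Proof. by rewrite ltr_pwDl// sqr_ge0. Qed.

(** At fixed slope [t] the Gaussian exponent is [a * x ^+ 2 / 2], and by homogeneity the ball
    condition reads [x * N (1, t) <= 1], so [integral_radial] applies. The factor [g] of the
    normalisation cancels against that of [a]. *)
Let integral_polar g t : 0 < g ->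
  (\int[mu]_x (polar g (x, t))%:E =
   ((1 - (0 < N (1, t))%R%:R * expR (- (g * radial_decay t))) /
     (2 * pi * (1 + t ^+ 2)))%:E)%E.
Proof.
move=> g0; pose a := g * (1 + t ^+ 2).
have a0 : 0 < a by rewrite mulr_gt0.
pose h (x : R) := x * (if x * N (1, t) <= 1 then expR (- (a * x ^+ 2 / 2)) else 0).
have mh : measurable_fun setT h.
  apply: measurable_funM => //; apply: measurable_fun_ifT => //.
    by apply: measurable_fun_ler => //; exact: measurable_funM.
  apply: measurableT_comp => //; apply: measurableT_comp => //.
  by apply: measurable_funM => //; apply: measurable_funM => //; exact: measurable_funX.
transitivity (\int[mu]_(x in `[0%R, +oo[) ((g / (2 * pi))%:E * (h x)%:E))%E.
  rewrite [RHS]integral_mkcond; apply: eq_integral => x _.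
  rewrite patchE mem_setE in_itv/= andbT /polar/=.
  case: ltgtP => //= [x0|<-]; last by rewrite /h mul0r mule0.
  rewrite -EFinM /h /gauge_ball_gauss N_scale// /gauss2/=; congr EFin.
  case: ifP => _; last by rewrite !mulr0.
  rewrite mulrCA; congr (_ * (_ * expR (- _))).
  by rewrite /a; field.
rewrite ge0_integralZl_EFin//=; last 3 first.
- move=> x; rewrite in_itv/= andbT => x0; rewrite lee_fin mulr_ge0//.
  by case: ifP => // _; exact: expR_ge0.
- by apply/measurable_EFinP; exact: measurable_funTS.
- by rewrite divr_ge0 ?mulr_ge0 ?pi_ge0// ltW.
rewrite /h (integral_radial a0)// -EFinM; congr EFin.
have -> : a / (2 * N (1, t) ^+ 2) = g * radial_decay t by rewrite /a /radial_decay -mulrA.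
rewrite /a; move: (@pi R) (pi_gt0 R) => p p0; field.
by rewrite !gt_eqF.
Qed.

Lemma halfplane_gauge_ball_gauss g : 0 < g ->
  (\int[mu]_(x in `[0%R, +oo[) \int[mu]_y (gauge_ball_gauss g (x, y))%:E =
   \int[mu]_t ((1 - (0 < N (1, t))%R%:R * expR (- (g * radial_decay t))) /
     (2 * pi * (1 + t ^+ 2)))%:E)%E.
Proof.
move=> g0.
have mf : measurable_fun setT (fun z => (gauge_ball_gauss g z)%:E).
  by apply/measurable_EFinP; exact: measurable_gauge_ball_gauss.
have f0 z : (0 <= (gauge_ball_gauss g z)%:E)%E by rewrite lee_fin gauge_ball_gauss_ge0.
(* The substitution [y = x * t] requires [x] nonzero, so the null endpoint 0 is removed first. *)
rewrite -integral_itv_obnd_cbnd; last first.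
  have mF := @measurable_fun_fubini_tonelli_F _ _ (measurableTypeR R)
    (measurableTypeR R) R (@lebesgue_measure R) _ mf f0.
  exact: measurable_funTS mF.
rewrite [LHS]integral_mkcond.
transitivity (\int[mu]_x \int[mu]_t (polar g (x, t))%:E)%E.
  apply: eq_integral => x _; rewrite patchE mem_setE in_itv/= andbT /polar/=.
  case: ifP => x0; last by rewrite integral0.
  rewrite (ge0_integral_scale x0)//.
  by apply: (measurableT_comp mf); exact: pair1_measurable.
have mp : measurable_fun setT (fun z => (polar g z)%:E).
  by apply/measurable_EFinP; exact: measurable_polar.
have p0 z : (0 <= (polar g z)%:E)%E by rewrite lee_fin polar_ge0.
rewrite [LHS](@fubini_tonelli _ _ (measurableTypeR R) (measurableTypeR R) R
  (@lebesgue_measure R) (@lebesgue_measure R) _ mp p0).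
by apply: eq_integral => t _; exact: integral_polar.
Qed.

End gauge.

(** * The angular density in the slope variable *)

Section cauchy_density.
Context {R : realType}.
Local Notation mu := (@lebesgue_measure R).

(** Half of the standard Cauchy density: the uniform law of the angle, restricted to one half-plane
    and read on slopes, of total mass 1/2. *)
Definition cauchy_density (t : R) : R := (2 * pi * (1 + t ^+ 2))^-1.

Lemma cauchy_density_gt0 t : 0 < cauchy_density t.
Proof. by rewrite invr_gt0 !mulr_gt0 ?pi_gt0// ltr_pwDl// sqr_ge0. Qed.

Lemma continuous_cauchy_density : continuous cauchy_density.
Proof.
move=> t; apply: cvgV.
  by rewrite -invr_eq0 gt_eqF// -/(cauchy_density t) cauchy_density_gt0.
apply: cvgM; first exact: cvg_cst.
exact: continuous_oneDsqr.
Qed.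

Lemma measurable_cauchy_density : measurable_fun setT cauchy_density.
Proof. by apply: continuous_measurable_fun; exact: continuous_cauchy_density. Qed.

Lemma integral_cauchy_density :
  (\int[mu]_t (cauchy_density t)%:E = (2^-1)%:E)%E.
Proof.
rewrite ge0_symfun_integralT; last 3 first.
- by move=> t; exact/ltW/cauchy_density_gt0.
- exact: continuous_cauchy_density.
- by move=> t; rewrite /cauchy_density/= sqrrN.
rewrite -set_itvcy; under eq_integral do rewrite /cauchy_density invfM EFinM.
rewrite ge0_integralZl_EFin//=; last 3 first.
- by move=> t _; rewrite lee_fin invr_ge0 addr_ge0 ?sqr_ge0.
- apply/measurable_EFinP; apply: measurable_funTS; apply: continuous_measurable_fun.
  exact: continuous_oneDsqrV.
- by rewrite invr_ge0 mulr_ge0 ?pi_ge0.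
rewrite [X in (_ * (_ * X))%E](integral0y_oneDsqr R) -!EFinM; congr EFin.
by move: (@pi R) (pi_gt0 R) => p p0; field; rewrite gt_eqF.
Qed.

Lemma integrable_cauchy_density : mu.-integrable setT (EFin \o cauchy_density).
Proof.
apply/integrableP; split.
  by apply/measurable_EFinP; exact: measurable_cauchy_density.
under eq_integral do rewrite /= ger0_norm ?(ltW (cauchy_density_gt0 _))//.
by rewrite integral_cauchy_density ltry.
Qed.

End cauchy_density.

(** * Half-plane masses as Laplace transforms *)

Section gauge_laplace.
Context {R : realType}.
Local Notation mu := (@lebesgue_measure R).
Variable N : R * R -> R.
Hypothesis N_ge0 : forall z, 0 <= N z.
Hypothesis N_scale : forall x t, 0 < x -> N (x, x * t) = x * N (1, t).
Hypothesis mN : measurable_fun setT N.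

Lemma radial_decay_ge0 t : 0 <= radial_decay N t.
Proof. by apply: divr_ge0; [rewrite addr_ge0// sqr_ge0|rewrite mulr_ge0// sqr_ge0]. Qed.

Let mN1 : measurable_fun setT (fun t => N (1, t)).
Proof. by apply: (measurableT_comp mN); exact: pair1_measurable. Qed.

Lemma measurable_radial_decay : measurable_fun setT (radial_decay N).
Proof.
(* The inverse is written as the power -1, whose measurability is known; the two agree at base 0
   too, where both are 0. *)
rewrite (_ : radial_decay N =
    fun t => (1 + t ^+ 2) * (2 * N (1, t) ^+ 2) `^ (-1)); last first.
  by apply/funext => t; rewrite powR_inv1// mulr_ge0// sqr_ge0.
apply: measurable_funM; first by apply: measurable_funD => //; exact: measurable_funX.
apply: (measurableT_comp (measurable_powR (-1))).
by apply: measurable_funM => //; exact: measurable_funX.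
Qed.

Lemma radial_weight_ge0 t : 0 <= radial_weight N t.
Proof. by rewrite /radial_weight mulr_ge0// ltW// cauchy_density_gt0. Qed.

Lemma measurable_radial_weight : measurable_fun setT (radial_weight N).
Proof.
apply: measurable_funM; last exact: measurable_cauchy_density.
rewrite (_ : (fun _ => _) = fun t => if 0 < N (1, t) then 1 else 0); last first.
  by apply/funext => t; case: ifP.
by apply: measurable_fun_ifT => //; exact: measurable_fun_ltr.
Qed.

(** The exponential is at most 1 and the weight at most the integrable [cauchy_density]. *)
Lemma radial_laplace_integrable :
  laplace_integrable mu (radial_decay N) (radial_weight N).
Proof.
move=> g g0; apply: le_integrable integrable_cauchy_density => //.
  apply/measurable_EFinP; apply: measurable_funM; first exact: measurable_radial_weight.
  apply: measurableT_comp => //; apply: measurableT_comp => //.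
  by apply: measurable_funM => //; exact: measurable_radial_decay.
move=> t _ /=; have c0 := ltW (cauchy_density_gt0 t); have w0 := radial_weight_ge0 t.
rewrite lee_fin (ger0_norm c0) ger0_norm ?mulr_ge0 ?expR_ge0//.
apply: (@le_trans _ _ (radial_weight N t)).
  by rewrite ler_piMr// -expR0 ler_expR oppr_le0 mulr_ge0 ?radial_decay_ge0// ltW.
by rewrite /radial_weight ler_piMl//; case: (0 < _).
Qed.

Lemma halfplane_laplace g : 0 < g ->
  (\int[mu]_(x in `[0%R, +oo[) \int[mu]_y (gauge_ball_gauss N g (x, y))%:E =
   (2^-1 - laplace mu (radial_decay N) (radial_weight N) g)%:E)%E.
Proof.
move=> g0; rewrite halfplane_gauge_ball_gauss// EFinB -integral_cauchy_density.
have wi := radial_laplace_integrable g0.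
rewrite /laplace /Rintegral fineK; last exact: integrable_fin_num.
rewrite -integralB//; last exact: integrable_cauchy_density.
apply: eq_integral => t _; rewrite /= -EFinB; congr EFin.
by rewrite mulrBl mul1r /radial_weight /cauchy_density (mulrAC _ (expR _)).
Qed.

(** The weight of the second derivative, in the form produced by two uses of [is_derive_laplace];
    the signs cancel, so it is nonnegative. *)
Let w2 t := - radial_decay N t * (- radial_decay N t * radial_weight N t).

Lemma radial_laplace_derive (g : R) : 0 < g ->
  is_derive g 1 (laplace mu (radial_decay N) (radial_weight N))
    (laplace mu (radial_decay N) (fun t => - radial_decay N t * radial_weight N t) g).
Proof.
move=> g0; apply: is_derive_laplace => //.
- exact: radial_decay_ge0.
- exact: radial_laplace_integrable.
Qed.

Let radial_laplace_integrable1 :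
  laplace_integrable mu (radial_decay N) (fun t => - radial_decay N t * radial_weight N t).
Proof.
apply: laplace_integrableM.
- exact: measurable_radial_decay.
- exact: radial_decay_ge0.
- exact: measurable_radial_weight.
- exact: radial_laplace_integrable.
Qed.

Let mw1 : measurable_fun setT (fun t => - radial_decay N t * radial_weight N t).
Proof.
apply: measurable_funM; last exact: measurable_radial_weight.
by apply: measurableT_comp => //; exact: measurable_radial_decay.
Qed.

Lemma radial_laplace_derive2 (g : R) : 0 < g ->
  is_derive g 1
    (laplace mu (radial_decay N) (fun t => - radial_decay N t * radial_weight N t))
    (laplace mu (radial_decay N) w2 g).
Proof.
move=> g0; apply: is_derive_laplace => //.
exact: radial_decay_ge0.
Qed.

Let w2_ge0 t : 0 <= w2 t.
Proof. by rewrite /w2 mulrA mulrNN mulr_ge0 ?radial_weight_ge0// -expr2 sqr_ge0. Qed.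

Lemma radial_laplace2_ge0 g : 0 <= laplace mu (radial_decay N) w2 g.
Proof. by apply: Rintegral_ge0 => t _; rewrite mulr_ge0 ?expR_ge0. Qed.

(** Slopes in [A] are directions in which the ball is bounded; there the decay and the weight are
    both positive. *)
Lemma radial_laplace2_gt0 (A : set R) g : 0 < g -> measurable A ->
  (0 < mu A)%E -> (forall t, A t -> 0 < N (1, t)) ->
  0 < laplace mu (radial_decay N) w2 g.
Proof.
move=> g0 mA muA NA; apply: (@Rintegral_gt0 _ _ _ mu _ A) => //.
- apply: laplace_integrableM => //; first exact: measurable_radial_decay.
  exact: radial_decay_ge0.
- by move=> t; rewrite mulr_ge0 ?expR_ge0.
- move=> t /NA Nt; rewrite mulr_gt0 ?expR_gt0// /w2 mulrA mulrNN mulr_gt0//.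
    have u0 : 0 < radial_decay N t.
      by rewrite /radial_decay divr_gt0 ?mulr_gt0 ?exprn_gt0// ltr_pwDl// sqr_ge0.
    by rewrite mulr_gt0.
  by rewrite /radial_weight Nt mul1r cauchy_density_gt0.
Qed.

End gauge_laplace.

(** * Gauges of planar polyhedra *)

Section polyhedral_gauge.
Context {R : realType} {I : finType}.
Local Notation mu := (@lebesgue_measure R).
Implicit Types c d : I -> R.

(** The Minkowski functional of the polyhedron [c j * x + d j * y <= 1]. Starting the maximum at 0
    gives value 0 in the directions in which the polyhedron is unbounded. *)
Definition polyhedral_gauge c d (z : R * R) : R :=
  \big[Num.max/0]_j (c j * z.1 + d j * z.2).

Lemma polyhedral_gauge_ge0 c d z : 0 <= polyhedral_gauge c d z.
Proof. exact: bigmax_ge_id. Qed.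

Lemma polyhedral_gauge_scale c d (x t : R) : 0 < x ->
  polyhedral_gauge c d (x, x * t) = x * polyhedral_gauge c d (1, t).
Proof.
move=> x0; rewrite /polyhedral_gauge /=.
rewrite (big_endo ( *%R x)) ?mulr0//; last by move=> u v; rewrite maxr_pMr// ltW.
by apply: eq_bigr => j _; rewrite mulr1 mulrDr mulrCA (mulrC (c j)).
Qed.

Lemma measurable_polyhedral_gauge c d : measurable_fun setT (polyhedral_gauge c d).
Proof.
rewrite /polyhedral_gauge; elim: (index_enum I) => [|j s IHs].
  by under eq_fun do rewrite big_nil; exact: measurable_cst.
under eq_fun do rewrite big_cons.
apply: measurable_maxr => //; apply: measurable_funD;
  exact: measurable_funM.
Qed.

(** The left half-plane thereby becomes a right half-plane for another polyhedral gauge, to which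
    the half-plane results apply. *)
Lemma gauge_ball_gaussN c d g (x y : R) :
  gauge_ball_gauss (polyhedral_gauge c d) g (- x, y) =
  gauge_ball_gauss (polyhedral_gauge (fun j => - c j) d) g (x, y).
Proof.
rewrite /gauge_ball_gauss /gauss2 /polyhedral_gauge /= sqrrN.
by under eq_bigr do rewrite mulrN -mulNr.
Qed.

(** One nontrivial constraint suffices. If [d j != 0], then [c j + d j * t] is positive on a
    half-line of slopes; if [d j = 0], the sign of [c j] selects the half-plane in which every slope
    works. *)
Lemma polyhedral_gauge_gt0 c d : (exists j, c j != 0 \/ d j != 0) ->
  exists A : set R, [/\ measurable A, (0 < mu A)%E &
    (forall t, A t -> 0 < polyhedral_gauge c d (1, t)) \/
    (forall t, A t -> 0 < polyhedral_gauge (fun j => - c j) d (1, t))].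
Proof.
move=> [j cd].
have gt0 c' t : 0 < c' j + d j * t -> 0 < polyhedral_gauge c' d (1, t).
  move=> h; apply: lt_le_trans h _.
  by apply: le_trans (le_bigmax _ _ j); rewrite mulr1.
have muT : (0 < mu setT)%E.
  by rewrite -set_itvNyy lebesgue_measure_itv/= addye// ltry.
have [d0|d0|d0] := ltgtP (d j) 0.
- exists `]-oo, - c j / d j[%classic; split => //.
    by rewrite lebesgue_measure_itv/= ltNyr addey// ltry.
  left => t /=; rewrite in_itv/= => h; apply: gt0.
  by move: h; rewrite ltr_ndivlMr// -subr_gt0 opprK addrC mulrC.
- exists `]- c j / d j, +oo[%classic; split => //.
    by rewrite lebesgue_measure_itv/= ltry addye// ltry.
  left => t /=; rewrite in_itv/= andbT => h; apply: gt0.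
  by move: h; rewrite ltr_pdivrMr// -subr_gt0 opprK addrC mulrC.
- have c0 : c j != 0 by case: cd => //; rewrite d0 eqxx.
  exists setT; split => //; have [cj|cj|cj] := ltgtP (c j) 0.
  + by right => t _; apply: gt0; rewrite d0 mul0r addr0 oppr_gt0.
  + by left => t _; apply: gt0; rewrite d0 mul0r addr0.
  + by rewrite cj eqxx in c0.
Qed.

(* l is the probability that a standard planar Gaussian, scaled to variance 1 / g,
   leaves the ball. *)
Lemma integral_polyhedral_gauge c d : (exists j, c j != 0 \/ d j != 0) ->
  exists l l1 l2 : R -> R, [/\
    forall g, 0 < g ->
      (\int[mu]_x \int[mu]_y (gauge_ball_gauss (polyhedral_gauge c d) g (x, y))%:E =
       (1 - l g)%:E)%E,
    forall g : R, 0 < g -> is_derive g 1 l (l1 g),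
    forall g : R, 0 < g -> is_derive g 1 l1 (l2 g) &
    forall g, 0 < g -> 0 < l2 g].
Proof.
move=> cd0; pose N1 := polyhedral_gauge c d.
pose N2 := polyhedral_gauge (fun j => - c j) d.
have N1_ge0 : forall z, 0 <= N1 z by exact: polyhedral_gauge_ge0.
have N2_ge0 : forall z, 0 <= N2 z by exact: polyhedral_gauge_ge0.
have N1_scale := @polyhedral_gauge_scale c d.
have N2_scale := @polyhedral_gauge_scale (fun j => - c j) d.
have mN1 := @measurable_polyhedral_gauge c d.
have mN2 := @measurable_polyhedral_gauge (fun j => - c j) d.
pose L N := laplace mu (radial_decay N) (radial_weight N).
pose L1 N := laplace mu (radial_decay N) (fun t => - radial_decay N t * radial_weight N t).
pose L2 N := laplace mu (radial_decay N)
  (fun t => - radial_decay N t * (- radial_decay N t * radial_weight N t)).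
(* [N1] serves the right half-plane and [N2] the reflected left one; each has Gaussian mass 1/2
   minus its Laplace transform. *)
exists (fun g => L N1 g + L N2 g), (fun g => L1 N1 g + L1 N2 g),
  (fun g => L2 N1 g + L2 N2 g).
split=> g g0.
- have mf : measurable_fun setT (fun z => (gauge_ball_gauss N1 g z)%:E).
    by apply/measurable_EFinP; exact: measurable_gauge_ball_gauss.
  have f0 z : (0 <= (gauge_ball_gauss N1 g z)%:E)%E.
    by rewrite lee_fin gauge_ball_gauss_ge0.
  have mF := @measurable_fun_fubini_tonelli_F _ _ (measurableTypeR R)
    (measurableTypeR R) R (@lebesgue_measure R) _ mf f0.
  rewrite ge0_integral_fold//; last first.
    by move=> x; apply: integral_ge0 => y _.
  under [X in (_ + X)%E]eq_integral do under eq_integral do rewrite gauge_ball_gaussN.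
  rewrite !halfplane_laplace// -EFinD; congr EFin.
  by rewrite -/N1 -/N2 /L; field.
- by apply: is_deriveD; apply: radial_laplace_derive.
- by apply: is_deriveD; apply: radial_laplace_derive2.
(* Strict positivity comes from one of the half-planes; the other contributes a nonnegative term. *)
- have [A [mA muA [NA|NA]]] := polyhedral_gauge_gt0 cd0.
  + apply: ltr_wpDr; first exact: radial_laplace2_ge0.
    exact: (@radial_laplace2_gt0 _ N1 mN1 A).
  + apply: ltr_wpDl; first exact: radial_laplace2_ge0.
    exact: (@radial_laplace2_gt0 _ N2 mN2 A).
Qed.

End polyhedral_gauge.

(** * Decision regions *)

Section lebesgue_rV_integral.
Context {R : realType}.
Local Open Scope ereal_scope.

(** Tonelli, since [lebesgue_rV] in dimension [n.+1] is a pushforward of a product measure. *)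
Lemma ge0_integral_lebesgue_rVS n (f : 'rV[R]_n.+1 -> \bar R) :
  measurable_fun setT f -> (forall v, 0 <= f v) ->
  \int[lebesgue_rV R n.+1]_v f v =
  \int[lebesgue_measure]_x \int[lebesgue_rV R n]_v f (cons_rV (x, v)).
Proof.
move=> mf f0.
have mc := @measurable_cons_rV R n.
transitivity (\int[(lebesgue_measure \x lebesgue_rV R n)]_z f (cons_rV z)).
  transitivity (\int[pushforward (lebesgue_measure \x lebesgue_rV R n) (@cons_rV R n)]_v f v).
    by apply: eq_measure_integral.
  by rewrite (ge0_integral_pushforward mc)// preimage_setT.
rewrite fubini_tonelli1//.
exact: measurableT_comp.
Qed.

Lemma integral_lebesgue_rV0 (f : 'rV[R]_0 -> \bar R) :
  measurable_fun setT f -> \int[lebesgue_rV R 0]_v f v = f 0%R.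
Proof. by move=> mf; rewrite integral_dirac// diracT mul1e. Qed.

End lebesgue_rV_integral.

Section decision_region.
Context {R : realType} {n M : nat}.
Variables (s : 'I_M -> 'rV[R]_n) (i : 'I_M).
Hypothesis s_inj : injective s.

Lemma enorm_gt0 (x : 'rV[R]_n) : x != 0 -> 0 < enorm x.
Proof.
move=> /rV0Pn[k xk]; rewrite sqrtr_gt0 /dot (bigD1 k)//=.
rewrite ltr_pwDl//; first by rewrite -expr2 lt_neqAle eq_sym sqrf_eq0 xk sqr_ge0.
by apply: sumr_ge0 => j _; rewrite -expr2 sqr_ge0.
Qed.

Lemma enorm_sqr (x : 'rV[R]_n) : enorm x ^+ 2 = dot x x.
Proof. by rewrite sqr_sqrtr// sumr_ge0// => k _; rewrite -expr2 sqr_ge0. Qed.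

Lemma offset_gt0 j : j != i -> 0 < offset s i j.
Proof.
move=> ji; rewrite mulr_gt0 ?invr_gt0// enorm_gt0// subr_eq0.
by apply: contra ji => /eqP /s_inj ->.
Qed.

(* For j = i the offset and the normal vector are 0, so that facet i = 0 imposes
   no constraint. *)
Definition facet j : 'rV[R]_n := (offset s i j)^-1 *: normal_vec s i j.

Lemma facet_neq0 j : j != i -> facet j != 0.
Proof.
move=> ji; have o0 := offset_gt0 ji.
have sji : s j - s i != 0 by rewrite subr_eq0; apply: contra ji => /eqP /s_inj ->.
by rewrite !scaler_eq0 !negb_or !invr_eq0 (gt_eqF o0) sji gt_eqF// enorm_gt0.
Qed.

Lemma dotZl a (x y : 'rV[R]_n) : dot (a *: x) y = a * dot x y.
Proof. by rewrite /dot mulr_sumr; apply: eq_bigr => k _; rewrite mxE mulrA. Qed.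

Definition region_gauge (v : 'rV[R]_n) : R :=
  \big[Num.max/0]_(j < M) dot (facet j) v.

(** The points being distinct, the offsets are positive; dividing each constraint by its offset
    normalises the bound to 1. *)
Lemma decision_regionE v : decision_region s i v <-> region_gauge v <= 1.
Proof.
split=> [h|/bigmax_leP[_ h] j ji].
  apply/bigmax_leP; split=> // j _; rewrite dotZl.
  have [->|ji] := eqVneq j i.
    by rewrite /normal_vec subrr scaler0 -(scale0r 0) dotZl !mul0r mulr0.
  by rewrite ler_pdivrMl ?mulr1 ?offset_gt0// h.
by have := h j erefl; rewrite dotZl ler_pdivrMl ?mulr1 ?offset_gt0.
Qed.

Definition correct_pdf g v := if region_gauge v <= 1 then noise_pdf g v else 0.

Lemma measurable_dot (x : 'rV[R]_n) : measurable_fun setT (dot x).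
Proof.
by apply: measurable_sum => k; apply: measurable_funM => //; exact: measurable_coord.
Qed.

Lemma measurable_correct_pdf g : measurable_fun setT (correct_pdf g).
Proof.
apply: measurable_fun_ifT => //.
  apply: measurable_fun_ler => //; rewrite /region_gauge.
  elim: (index_enum 'I_M) => [|j r IHr].
    by under eq_fun do rewrite big_nil; exact: measurable_cst.
  under eq_fun do rewrite big_cons.
  by apply: measurable_maxr => //; exact: measurable_dot.
apply: measurable_funM => //; apply: measurableT_comp => //.
apply: measurableT_comp => //; apply: measurable_funM => //.
apply: measurable_funM => //.
under eq_fun do rewrite enorm_sqr.
by apply: measurable_sum => k; apply: measurable_funM; exact: measurable_coord.
Qed.

Lemma correct_pdf_ge0 g v : 0 <= correct_pdf g v.
Proof.
by rewrite /correct_pdf; case: ifP => // _; rewrite mulr_ge0 ?powR_ge0 ?expR_ge0.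
Qed.

Lemma prob_correct_givenE g :
  prob_correct_given s i g = fine (\int[lebesgue_rV R n]_v (correct_pdf g v)%:E)%E.
Proof.
rewrite /prob_correct_given /Rintegral integral_mkcond; congr fine.
apply: eq_integral => v _; rewrite patchE /correct_pdf; case: ifPn => [/set_mem|].
  by move=> /decision_regionE ->.
by rewrite notin_setE => vD; case: ifP => // /decision_regionE.
Qed.

End decision_region.

(** * Reduction of dimensions 1 and 2 to planar gauge balls *)

Section planar_reduction.
Context {R : realType} {M : nat}.
Local Notation mu := (@lebesgue_measure R).

Definition noise_pdf1 (g x : R) : R := (g / (2 * pi)) `^ 2^-1 * expR (- (g * x ^+ 2 / 2)).

Lemma noise_pdf1_ge0 g x : 0 <= noise_pdf1 g x.
Proof. by rewrite mulr_ge0 ?powR_ge0 ?expR_ge0. Qed.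

Lemma measurable_noise_pdf1 g : measurable_fun setT (noise_pdf1 g).
Proof.
apply: measurable_funM => //; apply: measurableT_comp => //.
apply: measurableT_comp => //; apply: measurable_funM => //.
by apply: measurable_funM => //; exact: measurable_funX.
Qed.

(** This is the normal density of mean 0 and standard deviation [Num.sqrt g^-1]. *)
Lemma integral_noise_pdf1 g : 0 < g -> (\int[mu]_x (noise_pdf1 g x)%:E = 1)%E.
Proof.
move=> g0; rewrite -(integral_normal_pdf 0 (Num.sqrt g^-1)).
apply: eq_integral => x _; congr EFin.
rewrite /normal_pdf sqrtr_eq0 leNgt invr_gt0 g0/= /normal_peak /normal_fun.
rewrite sqr_sqrtr ?invr_ge0 ?(ltW g0)// subr0 /noise_pdf1.
rewrite powR12_sqrt ?divr_ge0 ?mulr_ge0 ?pi_ge0 ?(ltW g0)// -sqrtrV; last first.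
  by rewrite mulrn_wge0// mulr_ge0 ?pi_ge0// invr_ge0 ltW.
congr (Num.sqrt _ * expR _).
  by move: (@pi R) (pi_gt0 R) => p p0; field; rewrite !gt_eqF.
by field; rewrite gt_eqF.
Qed.

Lemma gauss2E g (x y : R) : 0 < g -> gauss2 g (x, y) = noise_pdf1 g x * noise_pdf1 g y.
Proof.
move=> g0; have a0 : 0 < g / (2 * pi) by rewrite divr_gt0 ?mulr_gt0 ?pi_gt0.
rewrite /gauss2 /noise_pdf1 mulrACA -powRD; last by rewrite (gt_eqF a0) implybT.
rewrite -expRD (_ : 2^-1 + 2^-1 = 1) ?powRr1 ?(ltW a0)//; last by field.
by congr (_ * expR _) => /=; field.
Qed.

Lemma cons_rV_head n (z : measurableTypeR R * 'rV[R]_n) : cons_rV z ord0 ord0 = z.1.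
Proof. by rewrite mxE unlift_none. Qed.

Lemma cons_rV_tail n (z : measurableTypeR R * 'rV[R]_n) j :
  cons_rV z ord0 (lift ord0 j) = z.2 ord0 j.
Proof. by rewrite mxE liftK. Qed.

(** The second coordinate is an independent Gaussian left free by [d = 0]; it integrates to 1. *)
Lemma prob_correct_given1 (s : 'I_M -> 'rV[R]_1) i g : injective s -> 0 < g ->
  prob_correct_given s i g =
  fine (\int[mu]_x \int[mu]_y (gauge_ball_gauss
    (polyhedral_gauge (fun j => facet s i j ord0 ord0) (fun=> 0)) g (x, y))%:E)%E.
Proof.
move=> s_inj g0; rewrite prob_correct_givenE//; congr fine.
have mf : measurable_fun setT (fun v => (correct_pdf s i g v)%:E).
  by apply/measurable_EFinP; exact: measurable_correct_pdf.
rewrite ge0_integral_lebesgue_rVS//; last by move=> v; rewrite lee_fin correct_pdf_ge0.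
apply: eq_integral => x _.
rewrite integral_lebesgue_rV0; last first.
  apply: (measurableT_comp mf); apply: (measurableT_comp (@measurable_cons_rV R 0)).
  exact: pair1_measurable.
rewrite /gauge_ball_gauss /polyhedral_gauge /=.
under eq_integral do under eq_bigr do rewrite mul0r addr0.
have -> : correct_pdf s i g (cons_rV (x, 0)) =
    if \big[Num.max/0]_(j < M) (facet s i j ord0 ord0 * x) <= 1 then noise_pdf1 g x else 0.
  rewrite /correct_pdf /region_gauge /noise_pdf enorm_sqr /dot.
  under eq_bigr do rewrite big_ord1 cons_rV_head/=.
  by rewrite big_ord1 cons_rV_head/= /noise_pdf1 mul1r expr2.
case: ifPn => _; last by rewrite integral0.
under eq_integral do rewrite gauss2E// EFinM.
rewrite ge0_integralZl_EFin//= ?noise_pdf1_ge0//; last 2 first.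
- by move=> y _; rewrite lee_fin noise_pdf1_ge0.
- by apply/measurable_EFinP; exact: measurable_noise_pdf1.
by rewrite integral_noise_pdf1// mule1.
Qed.

Lemma prob_correct_given2 (s : 'I_M -> 'rV[R]_2) i g : injective s -> 0 < g ->
  prob_correct_given s i g =
  fine (\int[mu]_x \int[mu]_y (gauge_ball_gauss
    (polyhedral_gauge (fun j => facet s i j ord0 ord0)
      (fun j => facet s i j ord0 (lift ord0 ord0))) g (x, y))%:E)%E.
Proof.
move=> s_inj g0; rewrite prob_correct_givenE//; congr fine.
have mf : measurable_fun setT (fun v => (correct_pdf s i g v)%:E).
  by apply/measurable_EFinP; exact: measurable_correct_pdf.
rewrite ge0_integral_lebesgue_rVS//; last by move=> v; rewrite lee_fin correct_pdf_ge0.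
apply: eq_integral => x _.
have mfx : measurable_fun setT (fun v => (correct_pdf s i g (cons_rV (x, v)))%:E).
  apply: (measurableT_comp mf); apply: (measurableT_comp (@measurable_cons_rV R 1)).
  exact: pair1_measurable.
rewrite ge0_integral_lebesgue_rVS//; last by move=> v; rewrite lee_fin correct_pdf_ge0.
apply: eq_integral => y _.
rewrite integral_lebesgue_rV0; last first.
  apply: (measurableT_comp mfx); apply: (measurableT_comp (@measurable_cons_rV R 0)).
  exact: pair1_measurable.
have E (w : 'rV[R]_2) : dot w (cons_rV (x, cons_rV (y, 0))) =
    w ord0 ord0 * x + w ord0 (lift ord0 ord0) * y.
  by rewrite /dot !big_ord_recl big_ord0 cons_rV_tail !cons_rV_head addr0.
rewrite /correct_pdf /gauge_ball_gauss /region_gauge /polyhedral_gauge /=.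
under eq_bigr do rewrite E.
case: ifP => // _; congr EFin.
rewrite /noise_pdf enorm_sqr E cons_rV_tail !cons_rV_head/=.
(* In dimension 2 the exponent [n%:R / 2] of the normalising constant is 1. *)
rewrite /gauss2 /= divff// powRr1 ?expr2//.
by rewrite divr_ge0 ?mulr_ge0 ?pi_ge0// ltW.
Qed.

Lemma prob_error_given_derive2 n (s : 'I_M -> 'rV[R]_n) i :
  n = 1 \/ n = 2 -> (2 <= M)%N -> injective s ->
  exists l l1 l2 : R -> R, [/\
    forall g, 0 < g -> prob_error_given s i g = l g,
    forall g : R, 0 < g -> is_derive g 1 l (l1 g),
    forall g : R, 0 < g -> is_derive g 1 l1 (l2 g) &
    forall g, 0 < g -> 0 < l2 g].
Proof.
move=> hn hM s_inj.
(* A second constellation point gives a nonzero facet vector, so the decision region is not the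
   whole space. *)
have [j ji] : exists j, j != i.
  case: M hM i s s_inj => [//|[//|m]] _ i' _ _.
  by exists (lift i' ord0); rewrite eq_sym neq_lift.
have /rV0Pn[k fk] := facet_neq0 s_inj ji.
case: hn => hn; subst n.
  have [|l [l1 [l2 [lE dl dl1 l2_gt0]]]] := @integral_polyhedral_gauge R 'I_M
      (fun j => facet s i j ord0 ord0) (fun=> 0).
    by exists j; left; rewrite (ord1 k) in fk.
  exists l, l1, l2; split => // g g0.
  by rewrite /prob_error_given prob_correct_given1// lE//= subKr.
have [|l [l1 [l2 [lE dl dl1 l2_gt0]]]] := @integral_polyhedral_gauge R 'I_M
    (fun j => facet s i j ord0 ord0) (fun j => facet s i j ord0 (lift ord0 ord0)).
  exists j; case: (unliftP ord0 k) fk => [k' ->|->]; last by left.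
  by rewrite (ord1 k'); right.
exists l, l1, l2; split => // g g0.
by rewrite /prob_error_given prob_correct_given2// lE//= subKr.
Qed.

End planar_reduction.

(** * Averaging over the prior probabilities *)

Theorem theorem1 (R : realType) (n M : nat) (s : 'I_M -> 'rV[R]_n)
    (p : 'I_M -> R)
    (hn : n = 1%N \/ n = 2%N)
    (hM : (2 <= M)%N)
    (s_distinct : injective s)
    (s_normalized : M%:R^-1 * \sum_(i < M) enorm (s i) ^+ 2 = 1)
    (p_ge0 : forall i, 0 <= p i)
    (p_sum1 : \sum_(i < M) p i = 1) :
  [/\ convex_function (`]0, +oo[ : set R^o) (symbol_error_rate s p),
      convex_function (`]0, +oo[ : set R^o) (fun gamma => - prob_correct s p gamma)
    & forall gamma : R, 0 < gamma ->
        [/\ derivable (symbol_error_rate s p) gamma 1,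
            derivable (symbol_error_rate s p)^`() gamma 1
          & 0 < (symbol_error_rate s p)^`(2) gamma] /\
        [/\ derivable (prob_correct s p) gamma 1,
            derivable (prob_correct s p)^`() gamma 1
          & (prob_correct s p)^`(2) gamma < 0]].
Proof.
have /choice[l /choice[l1 /choice[l2 hl]]] i :=
  prob_error_given_derive2 i hn hM s_distinct.
pose S (g : R) := \sum_(i < M) l i g * p i.
pose S1 (g : R) := \sum_(i < M) l1 i g * p i.
pose S2 (g : R) := \sum_(i < M) l2 i g * p i.
have dsum (h h1 : 'I_M -> R -> R) (g : R) : (forall i, is_derive g 1 (h i) (h1 i g)) ->
    is_derive g 1 (fun g => \sum_(i < M) h i g * p i) (\sum_(i < M) h1 i g * p i).
  move=> dh; rewrite (_ : (fun _ => _) = \sum_(i < M) (fun g => h i g * p i)); last first.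
    by apply/funext => x; rewrite fct_sumE.
  apply: is_derive_sum => i.
  have := dh i => ?; apply: trigger_derive.
  by rewrite /GRing.scale/= mulr0 add0r mulrC.
have dS (g : R) : 0 < g -> is_derive g 1 (symbol_error_rate s p) (S1 g).
  (* The error rate is known to equal [S] only at positive SNR, that is, near [g]. *)
  move=> g0; apply: (@near_eq_is_derive _ _ _ S).
    near=> x; apply: eq_bigr => i _; have [-> //] := hl i.
    by near: x; exact: lt_nbhsr.
  by apply: dsum => i; have [_ + _ _] := hl i; exact.
have dS1 (g : R) : 0 < g -> is_derive g 1 S1 (S2 g).
  by move=> g0; apply: dsum => i; have [_ _ + _] := hl i; exact.
have S2_gt0 (g : R) : 0 < g -> 0 < S2 g.
  move=> g0.
  have l2_ge0 i : 0 <= l2 i g * p i by have [_ _ _ h] := hl i; rewrite mulr_ge0// ltW// h.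
  have S2_ge0 : 0 <= S2 g by apply: sumr_ge0.
  (* Some priors may be 0. If the whole sum vanished, each term would, and [l2 i g > 0] would force
     every [p i] to be 0, against their sum being 1. *)
  rewrite lt_neqAle S2_ge0 andbT eq_sym; apply/eqP => /eqP; rewrite psumr_eq0// => /allP h.
  have : \sum_(i < M) p i = 0.
    apply: big1 => i _; have := h i (mem_index_enum i).
    rewrite mulf_eq0 => /orP[/eqP|/eqP//].
    by have [_ _ _ /(_ g g0)] := hl i => /[swap] ->; rewrite ltxx.
  by rewrite p_sum1 => /eqP; rewrite oner_eq0.
have dC (g : R) : 0 < g -> is_derive g 1 (prob_correct s p) (- S1 g).
  move=> g0; have := dS _ g0 => ?; rewrite -sub0r.
  rewrite (_ : prob_correct s p = cst 1 - symbol_error_rate s p)//.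
  exact: is_deriveB.
have dC1 (g : R) : 0 < g -> is_derive g 1 (fun g => - S1 g) (- S2 g).
  by move=> g0; have := dS1 _ g0 => ?; exact: is_deriveN.
split.
- by apply: (convex_function_derive2 dS dS1) => g /S2_gt0 /ltW.
- apply: (@convex_function_derive2 _ _ S1 S2) => // [g g0|g /S2_gt0 /ltW//].
  by rewrite -[S1 g]opprK; have := dC _ g0 => ?; exact: is_deriveN.
- move=> g g0.
  have dS' := is_derive_derive1 dS dS1 g0.
  have dC' := is_derive_derive1 dC dC1 g0.
  have := dS _ g0 => ?; have := dC _ g0 => ?.
  split; split; try exact: ex_derive.
  + by rewrite derive1nS derive1n1 derive1E (@derive_val _ _ _ _ _ _ _ dS') S2_gt0.
  + by rewrite derive1nS derive1n1 derive1E (@derive_val _ _ _ _ _ _ _ dC') oppr_lt0 S2_gt0.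
Unshelve. all: by end_near. Qed.
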